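(* Let $Ob$ be the universe of objects of an information system, let $R$ be its indiscernibility relation, and for $A \subseteq Ob$ let $\mu_A : Ob \to \{0, 1/2, 1\}$ be the associated membership function. The membership function extends to the operations $\odot$, $\uplus$ and $\neg$ between sets; that is, for all $A, B \subseteq Ob$ and all $x \in Ob$, $$\mu_{A \odot B}(x) = \min(\mu_A(x), \mu_B(x)), \qquad \mu_{A \uplus B}(x) = \max(\mu_A(x), \mu_B(x)), \qquad \mu_{\neg A}(x) = 1 - \mu_A(x).$$
   Context: An information system is a system $(Ob, Att, \{Val_a : a \in Att\}, f)$ where $Ob$ is a nonempty set (the universe of objects), $Att$ is a nonempty finite set of attributes, each $Val_a$ is a nonempty set of values of the attribute $a$, and $f : Ob \times Att \to \bigcup_{a \in Att} Val_a$ is a function with $f(x,a) \in Val_a$ for all $x \in Ob$, $a \in Att$. Its indiscernibility relation $R$ is the equivalence relation on $Ob$ given by: $x R y$ if and only if $f(x,a) = f(y,a)$ for every $a \in Att$. Let $R^{\ast}$ be the set of equivalence classes of $R$. For $A \subseteq Ob$ write $\neg A = Ob \setminus A$ and $$MA = \bigcup \{C \in R^{\ast} : C \cap A \neq \emptyset\}, \qquad LA = \neg M \neg A = \bigcup \{C \in R^{\ast} : C \subseteq A\}.$$ For $A, B \subseteq Ob$ define $$A \odot B = MA \cap B \cap (A \cup M \neg B), \qquad A \uplus B = LA \cup B \cup (A \cap L \neg B).$$ The membership function $\mu_A : Ob \to \{0, 1/2, 1\}$ associated to $A \subseteq Ob$ is defined by: $\mu_A(x) = 1$ iff $x \in LA$;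 $\mu_A(x) = 1/2$ iff $x \in MA \cap \neg LA$; $\mu_A(x) = 0$ iff $x \in \neg MA$. *)

(* Defs.v *)
From mathcomp Require Import all_boot all_order all_algebra.
From mathcomp Require Import mathcomp_extra boolp classical_sets.

Set Implicit Arguments.
Unset Strict Implicit.
Unset Printing Implicit Defensive.
Import Order.TTheory GRing.Theory Num.Theory.

Local Open Scope classical_set_scope.
Local Open Scope ring_scope.

(* The value sets [vals a] live in a common ambient type [univ], so that they
   may overlap and their union makes sense, as for sets. *)
Record info_system := InfoSystem {
  Ob : Type;
  Att : finType;
  univ : Type;
  vals : Att -> set univ;
  info : Ob * Att -> univ;
  Ob_neq0 : [set: Ob] !=set0;
  Att_neq0 : (0 < #|Att|)%N;
  vals_neq0 : forall a, vals a !=set0;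
  info_vals : forall x a, vals a (info (x, a))
}.

Section Defs.
Variable S : info_system.
Implicit Types (A B C : set (Ob S)) (x y : Ob S).

Definition indisc x y : Prop := forall a : Att S, info (x, a) = info (y, a).

Definition classes : set (set (Ob S)) :=
  [set C | exists x, C = [set y | indisc x y]].

Definition upper A : set (Ob S) :=
  \bigcup_(C in [set C | classes C /\ C `&` A !=set0]) C.

Definition lower A : set (Ob S) := ~` upper (~` A).

Definition odot A B : set (Ob S) := upper A `&` B `&` (A `|` upper (~` B)).

Definition uplus A B : set (Ob S) := lower A `|` B `|` (A `&` lower (~` B)).

(* Rational-valued, so that min, max and 1 - _ are the usual ones; [muP] below
   gives the three defining equivalences and the range {0, 1/2, 1}. *)
Definition mu A x : rat :=
  if x \in lower A then 1 else if x \in upper A then 1 / 2 else 0.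

Lemma indisc_refl x : indisc x x. Proof. by []. Qed.

Lemma indisc_sym x y : indisc x y -> indisc y x.
Proof. by move=> xy a; rewrite xy. Qed.

Lemma indisc_trans x y z : indisc x y -> indisc y z -> indisc x z.
Proof. by move=> xy yz a; rewrite xy yz. Qed.

Lemma upperP A x : upper A x <-> exists2 y, indisc x y & A y.
Proof.
split=> [[C [[z ->] [y [/= zy Ay]]] /= zx]|[y xy Ay]].
  by exists y => //; apply: indisc_trans zy; apply: indisc_sym.
exists [set z | indisc x z]; last exact: indisc_refl.
by split; [exists x | exists y].
Qed.

Lemma lowerE A : lower A = \bigcup_(C in [set C | classes C /\ C `<=` A]) C.
Proof.
apply/seteqP; split=> x.
  move=> LAx; exists [set y | indisc x y]; last exact: indisc_refl.
  split; first by exists x.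
  by move=> y /= xy; apply: contrapT => nAy; apply: LAx; apply/upperP; exists y.
move=> [C [[z ->] CA] /= zx] /upperP[y xy]; apply.
by apply: CA; apply: indisc_trans xy.
Qed.

Lemma lower_sub_upper A : lower A `<=` upper A.
Proof.
move=> x LAx; apply/upperP; exists x; first exact: indisc_refl.
by apply: contrapT => nAx; apply: LAx; apply/upperP; exists x.
Qed.

Lemma muP A x :
  [/\ mu A x = 1 <-> lower A x,
      mu A x = 1 / 2 <-> (upper A `&` ~` lower A) x,
      mu A x = 0 <-> (~` upper A) x
    & [\/ mu A x = 0, mu A x = 1 / 2 | mu A x = 1]].
Proof.
rewrite /mu; case: ifPn => [/set_mem L|/negP L].
  have U := lower_sub_upper L.
  split; [by [] | | | by constructor 3].
  - by split=> // -[].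
  - by split=> [/eqP|/(_ U)//]; rewrite oner_eq0.
have {}L : ~ lower A x by move=> /mem_set.
case: ifPn => [/set_mem U|/negP U].
  split; [by split=> // /eqP | by split | | by constructor 2].
  by split=> [/eqP|/(_ U)//].
have {}U : ~ upper A x by move=> /mem_set.
split; [by split=> // /eqP | | by split | by constructor 1].
by split=> [/eqP|[]].
Qed.

End Defs.

(* Main.v *)
(* The operation [odot] is designed so that [upper] and [lower] both carry it to
   intersection: on an equivalence class contained in [B] it is the trace of [A],
   and on any other class meeting [A] it is the trace of [B].  Membership of a
   point in [lower] and [upper] determines [mu], which settles [odot];
   complementation exchanges the two approximations, and [uplus] is the
   De Morgan dual of [odot]. *)
Require Import Defs.
From mathcomp Require Import all_boot all_order all_algebra.
From mathcomp Require Import mathcomp_extra boolp classical_sets.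
From mathcomp Require Import lra.

Set Implicit Arguments.
Unset Strict Implicit.
Unset Printing Implicit Defensive.
Import Order.TTheory GRing.Theory Num.Theory.

Local Open Scope classical_set_scope.
Local Open Scope ring_scope.

Lemma upper_indisc (S : info_system) (A : set (Ob S)) (x y : Ob S) :
  indisc x y -> upper A x -> upper A y.
Proof.
move=> xy /upperP[z xz Az]; apply/upperP; exists z => //.
exact: indisc_trans (indisc_sym xy) xz.
Qed.

Lemma lowerP (S : info_system) (A : set (Ob S)) (x : Ob S) :
  lower A x <-> forall y, indisc x y -> A y.
Proof.
split=> [LAx y xy|xA /upperP[y /xA]//].
by apply: contrapT => nAy; apply: LAx; apply/upperP; exists y.
Qed.

(** From right to left, take a class meeting both [A] and [B]. If it meets the complement of [B],
    the last factor of [odot] holds on all of it and any of its points in [B] is a witness.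
    Otherwise it lies inside [B], and any of its points in [A] is one. *)
Lemma upper_odot (S : info_system) (A B : set (Ob S)) :
  upper (odot A B) = upper A `&` upper B.
Proof.
apply/seteqP; split=> x.
  move=> /upperP[y xy [[MAy By] _]]; split; last by apply/upperP; exists y.
  exact: upper_indisc (indisc_sym xy) MAy.
move=> [MAx MBx]; apply/upperP.
have [MnBx|LBx] := pselect (upper (~` B) x).
  have /upperP[y xy By] := MBx; exists y => //; split; last first.
    by right; exact: upper_indisc xy MnBx.
  by split=> //; exact: upper_indisc xy MAx.
have /upperP[y xy Ay] := MAx; exists y => //; split; last by left.
split; first exact: upper_indisc xy MAx.
exact: (lowerP B x).1 LBx y xy.
Qed.

(** A class inside [odot A B] lies in [B], so it misses [upper] of the complement of [B], and the
    last factor leaves only [A]. *)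
Lemma lower_odot (S : info_system) (A B : set (Ob S)) :
  lower (odot A B) = lower A `&` lower B.
Proof.
apply/seteqP; split=> x.
  move=> /lowerP L; have LBx : lower B x.
    by apply/lowerP => y /L[[]].
  split=> //; apply/lowerP => y xy; have [_ [//|MnBy]] := L y xy.
  by case: LBx; exact: upper_indisc (indisc_sym xy) MnBy.
move=> [LAx LBx]; have MAx := lower_sub_upper LAx.
move: LAx LBx => /lowerP LAx /lowerP LBx; apply/lowerP => y xy.
split; last by left; exact: LAx.
by split; [exact: upper_indisc xy MAx | exact: LBx].
Qed.

Lemma mu_odot (S : info_system) (A B : set (Ob S)) (x : Ob S) :
  mu (odot A B) x = Num.min (mu A x) (mu B x).
Proof.
rewrite /mu lower_odot upper_odot !in_setI.
have sub C : (x \in lower C) ==> (x \in upper C).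
  by apply/implyP => /set_mem LCx; apply/mem_set; exact: lower_sub_upper.
move: (sub A) (sub B).
(* The inclusions [sub] discard the cases in [lower] but not in [upper]; each remaining case is a
   closed computation in [rat]. *)
by case: (x \in lower A); case: (x \in upper A);
   case: (x \in lower B); case: (x \in upper B).
Qed.

Lemma mu_setC (S : info_system) (A : set (Ob S)) (x : Ob S) :
  mu (~` A) x = 1 - mu A x.
Proof.
rewrite /mu.
have -> : (x \in lower (~` A)) = (x \notin upper A).
  by rewrite /lower setCK in_setC.
have -> : (x \in upper (~` A)) = (x \notin lower A).
  by rewrite /lower in_setC negbK.
have : (x \in lower A) ==> (x \in upper A).
  by apply/implyP => /set_mem LAx; apply/mem_set; exact: lower_sub_upper.
by case: (x \in lower A); case: (x \in upper A).
Qed.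

Lemma uplusE (S : info_system) (A B : set (Ob S)) :
  uplus A B = ~` odot (~` A) (~` B).
Proof. by rewrite /uplus /odot /lower !setCI setCU !setCK. Qed.

Theorem proposition4p1 (S : info_system) (A B : set (Ob S)) (x : Ob S) :
  [/\ mu (odot A B) x = Num.min (mu A x) (mu B x),
      mu (uplus A B) x = Num.max (mu A x) (mu B x)
    & mu (~` A) x = 1 - mu A x].
Proof.
split; [exact: mu_odot | | exact: mu_setC].
rewrite uplusE mu_setC mu_odot !mu_setC.
(* What remains is that [t] going to [1 - t] reverses the order and so exchanges min and max. *)
by case: (leP (1 - mu A x)); case: (leP (mu A x)); lra.
Qed.
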